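(* Let a SISO polynomial structured system be given by $\mathcal K(s)$, $\mathbf B$, $\mathbf C$, $\mathbf H_\xi$ ($\xi\in\{2,\dots,d\}$), $\mathbf N_\eta$ ($\eta\in\{1,\dots,d-1\}$). Let $\sigma_i$ and $\mu_i$, $i\in\{1,\dots,\tilde r\}$, be interpolation points such that $\mathcal K(s)$ is invertible for all $s\in\{\sigma_i,\mu_i : i=1,\dots,\tilde r\}$. Define the subspaces $$\mathcal V_{\mathrm L}=\operatorname{range}\big(\mathcal K^{-1}(\sigma_1)\mathbf B,\dots,\mathcal K^{-1}(\sigma_{\tilde r})\mathbf B\big),$$ $$\mathcal V_{\mathrm N}=\sum_{\eta=1}^{d-1}\sum_{i=1}^{\tilde r}\operatorname{range}\Big(\mathcal K^{-1}(\sigma_i)\mathbf N_\eta\big(\underbrace{\mathcal K^{-1}(\sigma_i)\mathbf B\otimes\cdots\otimes\mathcal K^{-1}(\sigma_i)\mathbf B}_{\eta}\big)\Big),$$ $$\mathcal V_{\mathrm H}=\sum_{\xi=2}^{d}\sum_{i=1}^{\tilde r}\operatorname{range}\Big(\mathcal K^{-1}(\sigma_i)\mathbf H_\xi\big(\underbrace{\mathcal K^{-1}(\sigma_i)\mathbf B\otimes\cdots\otimes\mathcal K^{-1}(\sigma_i)\mathbf B}_{\xi}\big)\Big),$$ $$\mathcal W_{\mathrm L}=\operatorname{range}\big(\mathcal K^{-\top}(\mu_1)\mathbf C^\top,\dots,\mathcal K^{-\top}(\mu_{\tilde r})\mathbf C^\top\big),$$ $$\mathcal W_{\mathrm N}=\sum_{\eta=1}^{d-1}\sum_{i=1}^{\tilde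 r}\operatorname{range}\Big(\mathcal K^{-\top}(\sigma_i)(\mathbf N_\eta)_{(2)}\big(\underbrace{\mathcal K^{-1}(\sigma_i)\mathbf B\otimes\cdots\otimes\mathcal K^{-1}(\sigma_i)\mathbf B}_{\eta-1}\otimes\mathcal K^{-\top}(\mu_i)\mathbf C^\top\big)\Big),$$ $$\mathcal W_{\mathrm H}=\sum_{\xi=2}^{d}\sum_{i=1}^{\tilde r}\operatorname{range}\Big(\mathcal K^{-\top}(\sigma_i)(\mathbf H_\xi)_{(2)}\big(\underbrace{\mathcal K^{-1}(\sigma_i)\mathbf B\otimes\cdots\otimes\mathcal K^{-1}(\sigma_i)\mathbf B}_{\xi-1}\otimes\mathcal K^{-\top}(\mu_i)\mathbf C^\top\big)\Big).$$ Let $\mathbf V,\mathbf W$ be $n\times r$ matrices of full column rank with $$\operatorname{range}(\mathbf V)=\mathcal V_{\mathrm L}+\mathcal V_{\mathrm N}+\mathcal V_{\mathrm H},\qquad \operatorname{range}(\mathbf W)=\mathcal W_{\mathrm L}+\mathcal W_{\mathrm N}+\mathcal W_{\mathrm H},$$ and let the reduced-order model be constructed by Petrov–Galerkin projection with $\mathbf V$ and $\mathbf W$. If the reduced matrix $\widehat{\mathcal K}(s)=\mathbf W^\top\mathcal K(s)\mathbf V$ is nonsingular for $s\in\{\sigma_i,\mu_i\}$, $i\in\{1,\dots,\tilde r\}$, then for all $i\in\{1,\dots,\tilde r\}$, $\eta\in\{1,\dots,d-1\}$, $\xi\in\{2,\dots,d\}$ the multivariate transfer functions of the original and reduced-order models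 satisfy $$\mathbf F_{\mathrm L}(\sigma_i)=\widehat{\mathbf F}_{\mathrm L}(\sigma_i),\qquad \mathbf F_{\mathrm L}(\mu_i)=\widehat{\mathbf F}_{\mathrm L}(\mu_i),$$ $$\mathbf F^{(\eta)}_{\mathrm N}(\sigma_i,\dots,\sigma_i)=\widehat{\mathbf F}^{(\eta)}_{\mathrm N}(\sigma_i,\dots,\sigma_i),\qquad \mathbf F^{(\eta)}_{\mathrm N}(\sigma_i,\dots,\sigma_i,\mu_i)=\widehat{\mathbf F}^{(\eta)}_{\mathrm N}(\sigma_i,\dots,\sigma_i,\mu_i),$$ $$\mathbf F^{(\xi)}_{\mathrm H}(\sigma_i,\dots,\sigma_i)=\widehat{\mathbf F}^{(\xi)}_{\mathrm H}(\sigma_i,\dots,\sigma_i),\qquad \mathbf F^{(\xi)}_{\mathrm H}(\sigma_i,\dots,\sigma_i,\mu_i)=\widehat{\mathbf F}^{(\xi)}_{\mathrm H}(\sigma_i,\dots,\sigma_i,\mu_i).$$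
   Context: A (SISO) polynomial structured system is $(\mathcal L\mathbf x)(t)=\sum_{\xi=2}^d\mathbf H_\xi\,\mathbf x(t)^{\otimes\xi}+\sum_{\eta=1}^{d-1}\mathbf N_\eta\big(\mathbf u(t)\otimes\mathbf x(t)^{\otimes\eta}\big)+\mathbf B\mathbf u(t)$, $\mathbf y(t)=\mathbf C\mathbf x(t)$, with zero initial conditions, scalar input and output, $\mathbf x(t)\in\mathbb R^n$, $\mathbf B\in\mathbb R^{n\times1}$, $\mathbf C\in\mathbb R^{1\times n}$, $\mathbf H_\xi\in\mathbb R^{n\times n^\xi}$, $\mathbf N_\eta\in\mathbb R^{n\times n^\eta}$. Here $\mathcal L$ is a linear operator whose frequency-domain representation is an $n\times n$ matrix-valued function $\mathcal K(s)$ of a complex variable $s$, i.e. the Laplace transform of $\mathcal L\mathbf x$ is $\mathcal K(s)\mathbf X(s)$, $\mathbf X$ being the Laplace transform of $\mathbf x$ (e.g. $\mathcal K(s)=s\mathbf E-\mathbf A$, $s^2\mathbf M+s\mathbf D+\mathbf K$, or $s\mathbf E-\mathbf A-e^{-\tau s}\mathbf A_\tau$). Multivariate transfer functions: $\mathbf F_{\mathrm L}(s_1)=\mathbf C\mathcal K^{-1}(s_1)\mathbf B$; $\mathbf F^{(\xi)}_{\mathrm H}(s_1,\dots,s_{\xi+1})=\mathbf C\mathcal K^{-1}(s_{\xi+1})\mathbf H_\xi\big(\mathcal K^{-1}(s_\xi)\mathbf B\otimes\cdots\otimes\mathcal K^{-1}(s_1)\mathbf B\big)$, $\xi\in\{2,\dots,d\}$;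 $\mathbf F^{(\eta)}_{\mathrm N}(s_1,\dots,s_{\eta+1})=\mathbf C\mathcal K^{-1}(s_{\eta+1})\mathbf N_\eta\big(\mathcal K^{-1}(s_\eta)\mathbf B\otimes\cdots\otimes\mathcal K^{-1}(s_1)\mathbf B\big)$, $\eta\in\{1,\dots,d-1\}$. Petrov–Galerkin projection: given $\mathbf V,\mathbf W$ with the same number $r$ of columns, the reduced-order model has $\widehat{\mathcal K}(s)=\mathbf W^\top\mathcal K(s)\mathbf V$, $\widehat{\mathbf B}=\mathbf W^\top\mathbf B$, $\widehat{\mathbf C}=\mathbf C\mathbf V$, $\widehat{\mathbf H}_\xi=\mathbf W^\top\mathbf H_\xi\mathbf V^{\otimes\xi}$, $\widehat{\mathbf N}_\eta=\mathbf W^\top\mathbf N_\eta\mathbf V^{\otimes\eta}$, and $\widehat{\mathbf F}_{\mathrm L},\widehat{\mathbf F}^{(\xi)}_{\mathrm H},\widehat{\mathbf F}^{(\eta)}_{\mathrm N}$ are given by the same formulas with hatted quantities. Interpolation points may be complex, in which case $\mathbf V,\mathbf W$ and all ranges are over $\mathbb C$; $^\top$ is the transpose without conjugation, and $\mathcal K^{-\top}(s)=(\mathcal K(s)^{-1})^\top$. Matricization: for an $N$-way tensor $\boldsymbol{\mathcal X}\in\mathbb R^{n_1\times\cdots\times n_N}$, the mode-$m$ matricization $\boldsymbol X_{(m)}$ has entries $\boldsymbol X_{(m)}(i_m,j)=\boldsymbol{\mathcal X}(i_1,\dots,i_N)$, $j=1+\sum_{k\ne m}(i_k-1)J_k$,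 $J_k=\prod_{z<k,\,z\ne m}n_z$. $\mathbf H_\xi$ is the mode-1 matricization of a $(\xi+1)$-way tensor of size $n\times\cdots\times n$ and $\mathbf N_\eta$ is the mode-1 matricization of an $(\eta+1)$-way tensor of size $n\times\cdots\times n$; $(\mathbf H_\xi)_{(2)}\in\mathbb R^{n\times n^\xi}$ and $(\mathbf N_\eta)_{(2)}\in\mathbb R^{n\times n^\eta}$ denote their mode-2 matricizations. Standing assumption: these tensors are symmetric, meaning that $\mathbf H_\xi(\mathbf q_1\otimes\cdots\otimes\mathbf q_\xi)$ and $\mathbf N_\eta(\mathbf q_1\otimes\cdots\otimes\mathbf q_\eta)$ are invariant under permutations of the vectors $\mathbf q_k$. *)

(* Defs.v *)
From HB Require Import structures.
From mathcomp Require Import all_boot all_order all_fingroup all_algebra.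
From mathcomp Require Import reals.
From mathcomp Require Import mxtens complex.

Set Implicit Arguments.
Unset Strict Implicit.
Unset Printing Implicit Defensive.

Import Order.TTheory GRing.Theory Num.Theory.
Local Open Scope ring_scope.

Section Tensors.
Variables (R : nmodType) (n : nat).

Definition tensor (N : nat) := {ffun 'I_N -> 'I_n} -> R.

(* The 0-based column number sum_{l != m} i_l J_l, with
   J_l = prod_{z < l, z != m} n. *)
Definition unfold_col (N : nat) (m : 'I_N) (i : {ffun 'I_N -> 'I_n}) : nat :=
  (\sum_(l < N | l != m) i l * \prod_(z < N | (z < l) && (z != m)) n)%N.

(* Mode-m matricization, modes being numbered from 0.  Each entry is a sum
   with exactly one term (see [unfold_bij]). *)
Definition matricize (k : nat) (m : 'I_k.+1) (X : tensor k.+1) :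
    'M[R]_(n, n ^ k) :=
  \matrix_(a, j)
    \sum_(i : {ffun 'I_k.+1 -> 'I_n} | (i m == a) && (unfold_col m i == j))
      X i.

Definition mode1 (k : nat) (X : tensor k.+1) : 'M[R]_(n, n ^ k) :=
  matricize ord0 X.

(* [inord 1] is the second mode when k >= 1; for k = 0 there is none and the
   value is irrelevant. *)
Definition mode2 (k : nat) (X : tensor k.+1) : 'M[R]_(n, n ^ k) :=
  matricize (inord 1) X.

Lemma unfold_colE k (m : 'I_k.+1) i :
  unfold_col m i = (\sum_(l < k) i (lift m l) * n ^ l)%N.
Proof.
have sum_lift F : (\sum_(l | l != m) F l = \sum_(l < k) F (lift m l))%N.
  rewrite (reindex_omap (lift m) (unlift m)) /=; last first.
    by move=> z; case: unliftP => [j -> //|->]; rewrite eqxx.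
  by apply: eq_bigl => z; rewrite liftK eqxx andbT eq_sym neq_lift.
have prod_lift (P : pred 'I_k.+1) :
    (\prod_(l | P l && (l != m)) n = \prod_(l < k | P (lift m l)) n)%N.
  rewrite (reindex_omap (lift m) (unlift m)) /=; last first.
    by move=> z /andP[_]; case: unliftP => [j -> //|->]; rewrite eqxx.
  by apply: eq_bigl => z; rewrite liftK eqxx andbT eq_sym neq_lift andbT.
rewrite /unfold_col sum_lift; apply: eq_bigr => l _.
congr (_ * _)%N; rewrite (prod_lift (fun z => z < lift m l)%N).
rewrite (eq_bigl (fun z : 'I_k => z < l)%N); last first.
  by move=> z /=; rewrite !ltnNge leq_bump2.
by rewrite -(big_ord_widen k (fun=> n)) 1?ltnW // prod_nat_const card_ord.
Qed.

Lemma digits_lt k (f : 'I_k -> 'I_n) : (\sum_(l < k) f l * n ^ l < n ^ k)%N.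
Proof.
elim: k f => [|k IHk] f; first by rewrite big_ord0.
rewrite big_ord_recr /=.
apply: (@leq_trans ((f ord_max).+1 * n ^ k)).
  by rewrite mulSn -addSn leq_add2r IHk.
by rewrite expnS leq_mul2r ltn_ord orbT.
Qed.

Lemma digits_inj k (f f' : 'I_k -> 'I_n) :
  (\sum_(l < k) f l * n ^ l = \sum_(l < k) f' l * n ^ l)%N -> f =1 f'.
Proof.
elim: k f f' => [|k IHk] f f'; first by move=> _ [].
rewrite !big_ord_recr /= => eq_s.
have lt_f := digits_lt (fun l => f (widen_ord (leqnSn k) l)).
have lt_f' := digits_lt (fun l => f' (widen_ord (leqnSn k) l)).
have n_gt0 : (0 < n ^ k)%N by apply: leq_ltn_trans lt_f.
have eq_max : f ord_max = f' ord_max.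
  apply: val_inj; have := congr1 (divn^~ (n ^ k)%N) eq_s.
  by rewrite !(addnC _ (_ * _)%N) !divnMDl // !divn_small ?addn0.
move: eq_s; rewrite eq_max => /addIn /IHk eq_w l.
case: (unliftP ord_max l) => [j ->|-> //].
have -> : lift ord_max j = widen_ord (leqnSn k) j by apply/val_inj/lift_max.
exact: eq_w.
Qed.

Lemma unfold_col_lt k (m : 'I_k.+1) i : (unfold_col m i < n ^ k)%N.
Proof. by rewrite unfold_colE digits_lt. Qed.

Definition unfold (k : nat) (m : 'I_k.+1) (i : {ffun 'I_k.+1 -> 'I_n}) :
    'I_n * 'I_(n ^ k) :=
  (i m, Ordinal (unfold_col_lt m i)).

Lemma unfold_bij k (m : 'I_k.+1) : bijective (unfold m).
Proof.
apply: inj_card_bij; last first.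
  by rewrite card_prod !card_ord card_ffun !card_ord expnS.
move=> i i' [eq_m eq_c]; apply/ffunP => z.
case: (unliftP m z) => [l ->|-> //].
move: eq_c; rewrite !unfold_colE.
by move/(@digits_inj _ (fun l => i (lift m l)) (fun l => i' (lift m l))).
Qed.

Lemma matricizeE k (m : 'I_k.+1) (X : tensor k.+1) i :
  matricize m X (unfold m i).1 (unfold m i).2 = X i.
Proof.
rewrite mxE (big_pred1 i) // => i'.
by rewrite /= -[RHS](inj_eq (bij_inj (unfold_bij m))).
Qed.

End Tensors.

Section Kronecker.
Variables (R : pzRingType) (n : nat).

(* q_1 (x) ... (x) q_k as a column of length n ^ k. *)
Fixpoint kronv (k : nat) : ('I_k -> 'cV[R]_n) -> 'cV[R]_(n ^ k) :=
  match k with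
  | 0 => fun=> const_mx 1
  | k'.+1 => fun q =>
      castmx (esym (expnS n k'), erefl)
        (q ord0 *t kronv (fun l => q (lift ord0 l)))
  end.

Definition symmetric_mx (k : nat) (G : 'M[R]_(n, n ^ k)) : Prop :=
  forall (s : 'S_k) (q : 'I_k -> 'cV[R]_n),
    G *m kronv (fun l => q (s l)) = G *m kronv q.

End Kronecker.

(* Only [sysH xi] for 2 <= xi <= d and [sysN eta] for 1 <= eta <= d - 1 are
   meaningful. *)
Record polysys (F : fieldType) (n : nat) := PolySys {
  sysK : F -> 'M[F]_n;
  sysB : 'cV[F]_n;
  sysC : 'rV[F]_n;
  sysH : forall xi : nat, 'M[F]_(n, n ^ xi);
  sysN : forall eta : nat, 'M[F]_(n, n ^ eta)
}.

Definition complex_polysys (R : realType) (n : nat) (K : R[i] -> 'M[R[i]]_n)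
    (B : 'cV[R]_n) (C : 'rV[R]_n) (H N : forall k : nat, 'M[R]_(n, n ^ k)) :
    polysys R[i] n :=
  PolySys K (map_mx (real_complex R) B) (map_mx (real_complex R) C)
    (fun xi => map_mx (real_complex R) (H xi))
    (fun eta => map_mx (real_complex R) (N eta)).

Section System.
Variables (F : fieldType) (n : nat) (S : polysys F n).

Local Notation K := (sysK S).
Local Notation B := (sysB S).
Local Notation C := (sysC S).
Local Notation H := (sysH S).
Local Notation N := (sysN S).

Definition Kinv (s : F) : 'M[F]_n := invmx (K s).
Definition KinvT (s : F) : 'M[F]_n := (Kinv s)^T.

Definition F_L (s1 : F) : F := (C *m Kinv s1 *m B) ord0 ord0.

(* K^-1(s_k) B (x) ... (x) K^-1(s_1) B, the points being numbered
   s_1 = s ord0, ..., s_(k+1) = s ord_max. *)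
Definition rev_kron (k : nat) (s : 'I_k.+1 -> F) : 'cV[F]_(n ^ k) :=
  kronv (fun l : 'I_k => Kinv (s (widen_ord (leqnSn k) (rev_ord l))) *m B).

Definition F_H (xi : nat) (s : 'I_xi.+1 -> F) : F :=
  (C *m Kinv (s ord_max) *m H xi *m rev_kron s) ord0 ord0.

Definition F_N (eta : nat) (s : 'I_eta.+1 -> F) : F :=
  (C *m Kinv (s ord_max) *m N eta *m rev_kron s) ord0 ord0.

Definition petrov_galerkin (r : nat) (V W : 'M[F]_(n, r)) : polysys F r :=
  PolySys (fun s => W^T *m K s *m V) (W^T *m B) (C *m V)
    (fun xi => W^T *m H xi *m (V ^t xi))
    (fun eta => W^T *m N eta *m (V ^t eta)).

Definition colrange (m : nat) (A : 'M[F]_(n, m)) : {vspace 'cV[F]_n} :=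
  limg (linfun (mulmx A : 'cV[F]_m -> 'cV[F]_n)).

Section Subspaces.
Variables (d rt : nat) (sigma mu : 'I_rt -> F).
(* Mode-2 matricizations of the tensors behind [H] and [N]. *)
Variables (H2 N2 : forall k : nat, 'M[F]_(n, n ^ k)).

Definition V_L : {vspace 'cV[F]_n} :=
  colrange (\matrix_(a < n, i < rt) (Kinv (sigma i) *m B) a ord0).

Definition V_N : {vspace 'cV[F]_n} :=
  (\sum_(1 <= eta < d) \sum_(i < rt)
    colrange (Kinv (sigma i) *m N eta
              *m kronv (fun _ : 'I_eta => Kinv (sigma i) *m B)))%VS.

Definition V_H : {vspace 'cV[F]_n} :=
  (\sum_(2 <= xi < d.+1) \sum_(i < rt)
    colrange (Kinv (sigma i) *m H xi
              *m kronv (fun _ : 'I_xi => Kinv (sigma i) *m B)))%VS.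

Definition W_L : {vspace 'cV[F]_n} :=
  colrange (\matrix_(a < n, i < rt) (KinvT (mu i) *m C^T) a ord0).

(* K^-1(sigma_i) B (x) ... (x) K^-1(sigma_i) B (x) K^-T(mu_i) C^T, with
   k factors in total. *)
Definition mixed_kron (k : nat) (i : 'I_rt) : 'cV[F]_(n ^ k) :=
  kronv (fun l : 'I_k => if l.+1 == k then KinvT (mu i) *m C^T
                         else Kinv (sigma i) *m B).

Definition W_N : {vspace 'cV[F]_n} :=
  (\sum_(1 <= eta < d) \sum_(i < rt)
    colrange (KinvT (sigma i) *m N2 eta *m mixed_kron eta i))%VS.

Definition W_H : {vspace 'cV[F]_n} :=
  (\sum_(2 <= xi < d.+1) \sum_(i < rt)
    colrange (KinvT (sigma i) *m H2 xi *m mixed_kron xi i))%VS.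

End Subspaces.
End System.

(* Main.v *)
Require Import Defs.
From mathcomp Require Import all_boot all_order all_fingroup all_algebra.
From mathcomp Require Import reals.
From mathcomp Require Import mxtens complex.

Import Order.TTheory GRing.Theory Num.Theory.
Local Open Scope ring_scope.

Set Implicit Arguments.
Unset Strict Implicit.
Unset Printing Implicit Defensive.

(** The reduced model evaluates the transfer functions through its own solves
    [W^T K(s) V x = W^T b], and Galerkin projection solves the equation
    [K(s) x = b] exactly as soon as the true solution [K(s)^-1 b] lies in the
    range of [V] ([galerkin_exact]).  Transposing, the row [C K(s)^-1] is
    reproduced as soon as [K(s)^-T C^T] lies in the range of [W].  In either
    case the scalar [C K(s)^-1 b] is not changed by the reduction, whatever the
    right-hand side [b] ([transfer_match]).

    Every transfer function in the theorem is such a scalar, with [b = B] for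
    the linear one and [b = G (v (x) ... (x) v)], [v = K(sigma_i)^-1 B], for
    the others, where [G] is [N_eta] or [H_xi].  Since [V_L] contains [v],
    projection is exact for [v] too: [V] maps the reduced counterpart of [v]
    to [v].  A Kronecker power of [V] acts factor by factor
    ([ntensmx_kronv]), so the right-hand side of the reduced model is exactly
    [W^T b] ([transfer_kron_match]).  The last argument of the transfer
    function is then either [sigma_i], where [V_L], [V_N] and [V_H] put
    [K(sigma_i)^-1 b] in the range of [V], or [mu_i], where [W_L] puts
    [K(mu_i)^-T C^T] in the range of [W]. *)

Section KroneckerPowers.
Variables (F : fieldType) (n r : nat).

(** The recursion of the iterated Kronecker product starts at exponent one, so
    exponent zero needs the identification of [n * n ^ 0] with [n]. *)
Lemma ntensmxS_cast (V : 'M[F]_(n, r)) k :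
  V ^t k.+1 = castmx (esym (expnS n k), esym (expnS r k)) (V *t (V ^t k)).
Proof.
case: k => [|k]; last by rewrite ntensmxSS castmx_id.
rewrite ntensmx1 [V ^t 0]ntensmx0 tens_mx_scalar scale1r.
rewrite castmx_comp; symmetry; exact: castmx_id.
Qed.

Lemma eq_kronv k (q q' : 'I_k -> 'cV[F]_n) : q =1 q' -> kronv q = kronv q'.
Proof.
elim: k q q' => [//|k IHk] q q' eq_q /=.
by rewrite eq_q (IHk _ (fun l => q' (lift ord0 l))).
Qed.

(** Mixed-product rule for Kronecker powers. *)
Lemma ntensmx_kronv (V : 'M[F]_(n, r)) k (q : 'I_k -> 'cV[F]_r) :
  V ^t k *m kronv q = kronv (fun l => V *m q l).
Proof.
elim: k q => [|k IHk] q; first by rewrite ntensmx0 mul1mx.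
rewrite ntensmxS_cast /= -IHk -tensmx_mul mulmx_cast castmx_comp castmx_mul.
by rewrite castmx_id; congr (castmx _ _ *m _).
Qed.

End KroneckerPowers.

Section Galerkin.
Variables (F : fieldType) (n : nat).

Lemma colrangeP m (A : 'M[F]_(n, m)) (y : 'cV[F]_n) :
  reflect (exists x, y = A *m x) (y \in colrange A).
Proof.
apply: (iffP memv_imgP) => [[x _ ->]|[x ->]].
  by exists x; rewrite lfunE.
by exists x; rewrite ?memvf ?lfunE.
Qed.

(** The reduced solution is the coordinate vector of the true one: if
    [K^-1 b = V z], then [W^T b = (W^T K V) z]. *)
Lemma galerkin_exact r (V W : 'M[F]_(n, r)) (K : 'M[F]_n) (b : 'cV[F]_n) :
    K \in unitmx -> W^T *m K *m V \in unitmx ->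
    invmx K *m b \in colrange V ->
  V *m (invmx (W^T *m K *m V) *m (W^T *m b)) = invmx K *m b.
Proof.
move=> uK uKr /colrangeP[z def_z]; rewrite def_z; congr (_ *m _).
by rewrite -[b in LHS](mulKVmx uK) def_z !mulmxA -!(mulmxA (invmx _)) mulKmx.
Qed.

Variable S : polysys F n.

Section Projection.
Variables (r : nat) (V W : 'M[F]_(n, r)).
Let red := petrov_galerkin S V W.

(** A right-hand side [b] is transferred exactly when its solution lies in the
    trial space, or, by duality, when the adjoint output lies in the test
    space: the latter is [galerkin_exact] for the transposed system, in which
    [V] and [W] exchange roles. *)
Lemma transfer_match s (b : 'cV[F]_n) :
    sysK S s \in unitmx -> sysK red s \in unitmx ->
    (Kinv S s *m b \in colrange V)
      || (KinvT S s *m (sysC S)^T \in colrange W) ->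
  sysC S *m Kinv S s *m b = sysC red *m Kinv red s *m (W^T *m b).
Proof.
rewrite /KinvT /Kinv /= => uK uKr.
case/orP => [inV|inW].
  by rewrite -[LHS]mulmxA -(galerkin_exact uK uKr inV) !mulmxA.
have uKt : (sysK S s)^T \in unitmx by rewrite unitmx_tr.
have eqKr : V^T *m (sysK S s)^T *m W = (W^T *m sysK S s *m V)^T.
  by rewrite !trmx_mul trmxK mulmxA.
rewrite mulmxA; congr (_ *m b); rewrite trmx_inv in inW.
have := @galerkin_exact r W V _ _ uKt _ inW.
rewrite eqKr unitmx_tr => /(_ uKr) def_w.
apply: trmx_inj; rewrite [LHS]trmx_mul [RHS]trmx_mul trmxK trmx_inv -def_w.
by rewrite -trmx_inv -!trmx_mul.
Qed.

Lemma F_L_match s :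
    sysK S s \in unitmx -> sysK red s \in unitmx ->
    (Kinv S s *m sysB S \in colrange V)
      || (KinvT S s *m (sysC S)^T \in colrange W) ->
  F_L S s = F_L red s.
Proof. by move=> uK uKr inVW; rewrite /F_L transfer_match. Qed.

(** The first [k] arguments enter only through the vectors [K(s_l)^-1 B], and
    [V] maps the reduced ones to the full ones; the last argument enters only
    through the outer solve, to which [transfer_match] applies. *)
Lemma transfer_kron_match k (G : 'M[F]_(n, n ^ k)) (s : 'I_k.+1 -> F) :
    (forall l, sysK S (s l) \in unitmx) ->
    (forall l, sysK red (s l) \in unitmx) ->
    (forall l, l != ord_max -> Kinv S (s l) *m sysB S \in colrange V) ->
    (Kinv S (s ord_max) *m (G *m rev_kron S s) \in colrange V)
      || (KinvT S (s ord_max) *m (sysC S)^T \in colrange W) ->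
  sysC S *m Kinv S (s ord_max) *m G *m rev_kron S s
    = sysC red *m Kinv red (s ord_max) *m (W^T *m G *m (V ^t k))
      *m rev_kron red s.
Proof.
move=> uK uKr inV inVW.
have lift_kron : V ^t k *m rev_kron red s = rev_kron S s.
  rewrite ntensmx_kronv; apply: eq_kronv => l.
  rewrite (galerkin_exact (uK _) (uKr _)) //; apply: inV.
  by rewrite -val_eqE neq_ltn; apply/orP; left; exact: ltn_ord (rev_ord l).
by rewrite -mulmxA transfer_match // -!mulmxA lift_kron.
Qed.

(** When all arguments agree, exactness comes from the trial space; when the
    last one differs, it comes from the test space. *)
Lemma transfer_kron_diag_match k (G : 'M[F]_(n, n ^ k)) (a m : F)
    (s : 'I_k.+1 -> F) :
    sysK S a \in unitmx -> sysK S m \in unitmx ->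
    sysK red a \in unitmx -> sysK red m \in unitmx ->
    Kinv S a *m sysB S \in colrange V ->
    KinvT S m *m (sysC S)^T \in colrange W ->
    Kinv S a *m (G *m kronv (fun _ : 'I_k => Kinv S a *m sysB S))
      \in colrange V ->
    s = (fun=> a) \/ s = (fun l => if l == ord_max then m else a) ->
  sysC S *m Kinv S (s ord_max) *m G *m rev_kron S s
    = sysC red *m Kinv red (s ord_max) *m (W^T *m G *m (V ^t k))
      *m rev_kron red s.
Proof.
move=> uKa uKm uKra uKrm inVB inWC inVG [] ->.
  by apply: transfer_kron_match => //; rewrite inVG.
apply: transfer_kron_match => [l|l|l /negPf -> //|]; last first.
- by rewrite eqxx inWC orbT.
- by case: ifP.
- by case: ifP.
Qed.

End Projection.

Lemma V_L_mem rt (sigma : 'I_rt -> F) i :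
  Kinv S (sigma i) *m sysB S \in V_L S sigma.
Proof.
apply/colrangeP; exists (delta_mx i ord0); rewrite -colE.
by apply/colP => a; rewrite !mxE.
Qed.

Lemma W_L_mem rt (mu : 'I_rt -> F) i :
  KinvT S (mu i) *m (sysC S)^T \in W_L S mu.
Proof.
apply/colrangeP; exists (delta_mx i ord0); rewrite -colE.
by apply/colP => a; rewrite !mxE.
Qed.

Lemma memv_sum_colrange rt (a b : nat) (y : nat -> 'I_rt -> 'cV[F]_n) k i :
    (a <= k < b)%N ->
  y k i \in (\sum_(a <= j < b) \sum_(l < rt) colrange (y j l))%VS.
Proof.
move=> ak_b; rewrite (bigD1_seq k) ?mem_index_iota ?iota_uniq //=.
apply/(subvP (addvSl _ _))/(subvP (sumv_sup i _ (subvv _))) => //.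
by apply/colrangeP; exists 1%:M; rewrite mulmx1.
Qed.

Lemma V_N_mem d rt (sigma : 'I_rt -> F) i eta :
    (1 <= eta < d)%N ->
  Kinv S (sigma i) *m
    (sysN S eta *m kronv (fun _ : 'I_eta => Kinv S (sigma i) *m sysB S))
    \in V_N S d sigma.
Proof.
move=> eta_d; rewrite mulmxA.
exact: (memv_sum_colrange (fun j l => Kinv S (sigma l) *m sysN S j
  *m kronv (fun _ : 'I_j => Kinv S (sigma l) *m sysB S))).
Qed.

Lemma V_H_mem d rt (sigma : 'I_rt -> F) i xi :
    (2 <= xi <= d)%N ->
  Kinv S (sigma i) *m
    (sysH S xi *m kronv (fun _ : 'I_xi => Kinv S (sigma i) *m sysB S))
    \in V_H S d sigma.
Proof.
move=> xi_d; rewrite mulmxA.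
exact: (memv_sum_colrange (fun j l => Kinv S (sigma l) *m sysH S j
  *m kronv (fun _ : 'I_j => Kinv S (sigma l) *m sysB S))).
Qed.

End Galerkin.

Theorem theorem1 (R : realType) (n r d rt : nat)
    (K : R[i] -> 'M[R[i]]_n) (B : 'cV[R]_n) (C : 'rV[R]_n)
    (H N : forall k : nat, 'M[R]_(n, n ^ k))
    (tH tN : forall k : nat, tensor R n k.+1)
    (sigma mu : 'I_rt -> R[i]) (V W : 'M[R[i]]_(n, r)) :
  let sys := complex_polysys K B C H N in
  let red := petrov_galerkin sys V W in
  let H2 xi := map_mx (real_complex R) (mode2 (tH xi)) in
  let N2 eta := map_mx (real_complex R) (mode2 (tN eta)) in
  (forall xi, (2 <= xi <= d)%N -> H xi = mode1 (tH xi)) ->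
  (forall eta, (1 <= eta < d)%N -> N eta = mode1 (tN eta)) ->
  (forall xi, (2 <= xi <= d)%N -> symmetric_mx (H xi)) ->
  (forall eta, (1 <= eta < d)%N -> symmetric_mx (N eta)) ->
  (forall i, K (sigma i) \in unitmx /\ K (mu i) \in unitmx) ->
  \rank V = r -> \rank W = r ->
  colrange V = (V_L sys sigma + V_N sys d sigma + V_H sys d sigma)%VS ->
  colrange W = (W_L sys mu + W_N sys d sigma mu N2 + W_H sys d sigma mu H2)%VS ->
  (forall i, sysK red (sigma i) \in unitmx /\ sysK red (mu i) \in unitmx) ->
  forall i : 'I_rt,
    (F_L sys (sigma i) = F_L red (sigma i)
     /\ F_L sys (mu i) = F_L red (mu i))
    /\ (forall eta, (1 <= eta < d)%N ->
          F_N sys (fun _ : 'I_eta.+1 => sigma i)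
            = F_N red (fun _ : 'I_eta.+1 => sigma i)
          /\ F_N sys (fun l : 'I_eta.+1 => if l == ord_max then mu i else sigma i)
             = F_N red (fun l : 'I_eta.+1 => if l == ord_max then mu i else sigma i))
    /\ (forall xi, (2 <= xi <= d)%N ->
          F_H sys (fun _ : 'I_xi.+1 => sigma i)
            = F_H red (fun _ : 'I_xi.+1 => sigma i)
          /\ F_H sys (fun l : 'I_xi.+1 => if l == ord_max then mu i else sigma i)
             = F_H red (fun l : 'I_xi.+1 => if l == ord_max then mu i else sigma i)).
Proof.
move=> sys red H2 N2 _ _ _ _ uK _ _ rgV rgW uKr i.
have [uKs uKm] := uK i; have [uKrs uKrm] := uKr i.
have inVL : Kinv sys (sigma i) *m sysB sys \in colrange V.
  rewrite rgV -addvA; apply: (subvP (addvSl _ _)); exact: V_L_mem.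
have inWL : KinvT sys (mu i) *m (sysC sys)^T \in colrange W.
  rewrite rgW -addvA; apply: (subvP (addvSl _ _)); exact: W_L_mem.
have kron_match k G s :=
  @transfer_kron_diag_match _ _ sys r V W k G _ _ s uKs uKm uKrs uKrm inVL inWL.
split.
  split.
    exact: (@F_L_match _ _ sys r V W _ uKs uKrs (introT orP (or_introl inVL))).
  exact: (@F_L_match _ _ sys r V W _ uKm uKrm (introT orP (or_intror inWL))).
split=> k k_d.
  have inVN : Kinv sys (sigma i) *m (sysN sys k *m kronv (fun _ : 'I_k =>
      Kinv sys (sigma i) *m sysB sys)) \in colrange V.
    rewrite rgV; apply: (subvP (addvSl _ _)); apply: (subvP (addvSr _ _)).
    exact: V_N_mem.
  by split; rewrite /F_N (kron_match _ _ _ inVN) //; [left | right].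
have inVH : Kinv sys (sigma i) *m (sysH sys k *m kronv (fun _ : 'I_k =>
    Kinv sys (sigma i) *m sysB sys)) \in colrange V.
  rewrite rgV; apply: (subvP (addvSr _ _)); exact: V_H_mem.
by split; rewrite /F_H (kron_match _ _ _ inVH) //; [left | right].
Qed.
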